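(* Let $\ell>1$ be an integer and let $\Gamma$ be a strongly connected strongly $\ell$-walk-regular digraph with parameters $(\lambda_\ell,\mu_\ell,\nu_\ell)$ where $\mu_\ell=0$, and suppose that $\Gamma$ is not a complete digraph. Then $\Gamma$ is (isomorphic to) one of the following digraphs: (1) a directed $g$-cycle; (2) for some $g\ge 2$, a coclique extension of a directed $g$-cycle, that is, a digraph with vertex set $V=\bigcup_{i=1}^{g}V_i$, where the $V_i$ are nonempty and pairwise disjoint, and edge set $E=\bigcup_{i=1}^{g-1}(V_i\times V_{i+1})\cup (V_g\times V_1)$; (3) for some $m\ge 3$, the digraph with vertex set $\mathbb{Z}_m$ obtained from the directed $m$-cycle with edges $u\to u+1$ ($u\in\mathbb{Z}_m$) by adding the edge $0\to 2$; (4) for some $m\ge 3$, the digraph with vertex set $\mathbb{Z}_m$ obtained from the directed $m$-cycle with edges $u\to u+1$ ($u\in\mathbb{Z}_m$) by adding both the edge $0\to 2$ and the edge $1\to 3$ (indices modulo $m$).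
   Context: All digraphs are finite and simple: a digraph is a pair $(V,E)$ with $V$ a finite nonempty set of vertices and $E$ a set of ordered pairs of distinct vertices (no loops, no multiple edges; both $uv$ and $vu$ may be edges). A vertex $u$ is adjacent to $v$ if $uv\in E$. A walk of length $\ell$ from $u_0$ to $u_\ell$ is a sequence $(u_0,\dots,u_\ell)$ with $u_iu_{i+1}\in E$ for all $i$. A digraph is strongly connected if there is a walk from every vertex to every other vertex. The complete digraph has all ordered pairs of distinct vertices as edges. For $\ell>1$, a digraph is strongly $\ell$-walk-regular with parameters $(\lambda_\ell,\mu_\ell,\nu_\ell)$ if the number of walks of length $\ell$ from a vertex $u$ to a vertex $v$ equals $\lambda_\ell$ whenever $u$ is adjacent to $v$, $\mu_\ell$ whenever $u\ne v$ and $u$ is not adjacent to $v$, and $\nu_\ell$ whenever $u=v$. A directed $g$-cycle is the digraph on $\mathbb{Z}_g$ with edges $u\to u+1$. *)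

(* Defs.v *)
From mathcomp Require Import all_boot all_algebra.

Set Implicit Arguments.
Unset Strict Implicit.
Unset Printing Implicit Defensive.

Import GRing.Theory.
Local Open Scope ring_scope.

(* A digraph is a relation E on a finite type V of vertices; finiteness and   *)
(* the absence of multiple edges are built in, while nonemptiness of V and    *)
(* irreflexivity of E (no loops) are to be assumed separately.                *)

Definition strongly_connected (V : finType) (E : rel V) : Prop :=
  forall u v : V, connect E u v.

Definition complete_digraph (V : finType) (E : rel V) : Prop :=
  forall u v : V, E u v = (u != v).

(* The walk (u, u_1, ..., u_l) is represented by its tail (u_1, ..., u_l).    *)
Definition walks (V : finType) (E : rel V) (l : nat) (u v : V) :
    {set l.-tuple V} :=
  [set w : l.-tuple V | path E u w & last u w == v].

Definition strongly_walk_regular (V : finType) (E : rel V)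
    (l lambda mu nu : nat) : Prop :=
  forall u v : V,
    [/\ E u v -> #|walks E l u v| = lambda,
        u != v -> ~~ E u v -> #|walks E l u v| = mu
      & u = v -> #|walks E l u v| = nu].

Definition digraph_iso (V W : finType) (E : rel V) (F : rel W) : Prop :=
  exists2 f : V -> W, bijective f & forall u v : V, F (f u) (f v) = E u v.

(* 'Z_m has m elements only if m > 1, hence the lower bounds on g and m in    *)
(* every use of the following definitions.                                    *)

Definition dicycle (g : nat) : rel 'Z_g := [rel u v | v == u + 1].

(* The parts P i are indexed by residues modulo g, so that P 0 plays the role *)
(* of the last part V_g and V_g x V_1 needs no separate clause.               *)
Definition dicycle_coclique_extension (V : finType) (E : rel V) (g : nat) :
    Prop :=
  exists P : 'Z_g -> {set V},
    [/\ forall i, P i != set0,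
        forall i j, i != j -> [disjoint P i & P j],
        \bigcup_i P i = [set: V]
      & forall u v : V, E u v = [exists i, (u \in P i) && (v \in P (i + 1))]].

Definition dicycle_plus_02 (m : nat) : rel 'Z_m :=
  [rel u v | dicycle u v || (u == 0) && (v == 2)].

(* For m = 3 the edge 1 -> 3 is 1 -> 0. *)
Definition dicycle_plus_02_13 (m : nat) : rel 'Z_m :=
  [rel u v | [|| dicycle u v, (u == 0) && (v == 2) | (u == 1) && (v == 3)]].

(* Main.v *)
(* As mu = 0, every walk of length l ends at its origin u or at an            *)
(* out-neighbour of u.                                                        *)
(* If nu = 0, then E is exactly the relation "joined by a walk of length l",  *)
(* hence "joined by a walk of length 1 + k(l-1)" for every k. The vertices    *)
(* joined by walks of lengths divisible by l-1 form classes that have the     *)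
(* same in- and out-neighbours and that E permutes cyclically: case (2).      *)
(* If nu > 0, every vertex v has an out-neighbour f v with a walk of length   *)
(* l-1 from f v back to v. Iterating f gives a cycle c_0 -> c_1 -> ... with   *)
(* walks of length l-1 from c_(i+1) to c_i; so u -> c_(i+1) implies u = c_i   *)
(* or u -> c_i, and dually. A vertex off the cycle is therefore adjacent to   *)
(* all or none of the c_i; in fact to all of them, in both directions, and    *)
(* then the digraph is complete. If the cycle covers all vertices, then c_i   *)
(* is adjacent exactly to c_(i+1), ..., c_(i+t_i) with t_i <= t_(i+1) + 1,    *)
(* and if some t_j < k - 1, following the longest arcs for l steps from c_j   *)
(* shows that t = 1 except at two consecutive vertices, where t <= 2. This    *)
(* leaves the cases (1), (3) and (4).                                         *)

Require Import Defs.
From mathcomp Require Import all_boot all_algebra.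
From mathcomp Require Import zify.
Import GRing.Theory.

Set Implicit Arguments.
Unset Strict Implicit.
Unset Printing Implicit Defensive.

(** Only the existence of walks matters: [reach l u v] forces [u = v] or [E u v]. If [nu = 0],
    [reach l] coincides with [E], and [reach_eq_edge_coclique_extension] applies. If [nu > 0],
    iterating [f] gives a directed cycle [c], and by [outside_complete] it must span.
    Out-neighbourhoods are then arcs of lengths [t i] ([arc_boundP]). Walks of length [l] from a
    vertex whose arc is not full reach a whole run of indices, whose residues must fit into that
    arc; [greedy_bound] concludes that the [l - 1] longest arcs taken after the first exceed unit
    steps by at most one in total. These arcs start at almost every vertex, whence
    [arc_bound_almost_1]. *)

(** * Existence of walks of a given length *)

Section Reach.
Variables (V : finType) (E : rel V).
Implicit Types (u v w : V) (m n : nat).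

Definition reach n u v := walks E n u v != set0.

Lemma reachP n u v :
  reflect (exists p, [/\ size p = n, path E u p & last u p = v]) (reach n u v).
Proof.
apply: (iffP (set0Pn _)) => [[w]|[p [sz_p Ep <-]]].
  rewrite inE => /andP[Ew /eqP <-]; exists w.
  by rewrite size_tuple; split.
have sz: size p == n by apply/eqP.
by exists (Tuple sz); rewrite inE Ep eqxx.
Qed.

Lemma reach0 u v : reach 0 u v = (u == v).
Proof.
apply/reachP/eqP => [[[|x p] []] //|->].
by exists [::].
Qed.

Lemma reach1 u v : reach 1 u v = E u v.
Proof.
apply/reachP/idP => [[[|x [|y p]]] /= [//]|Euv].
  by move=> _ /andP[Eux _] <-.
by exists [:: v]; rewrite /= Euv.
Qed.

Lemma reach_add m n u v w : reach m u v -> reach n v w -> reach (m + n) u w.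
Proof.
move=> /reachP[p [<- Ep <-]] /reachP[q [<- Eq <-]].
by apply/reachP; exists (p ++ q); rewrite size_cat cat_path last_cat Ep.
Qed.

Lemma reach_split m n u w :
  reach (m + n) u w -> exists2 v, reach m u v & reach n v w.
Proof.
move=> /reachP[p [sz_p]]; rewrite -(cat_take_drop m p) cat_path last_cat.
move=> /andP[Ep1 Ep2] Ew; exists (last u (take m p)); apply/reachP.
  by exists (take m p); rewrite size_take_min sz_p; split=> //; lia.
by exists (drop m p); rewrite size_drop sz_p; split=> //; lia.
Qed.

Lemma connect_reach u v : connect E u v -> exists n, reach n u v.
Proof.
case/connectP=> p Ep ->; exists (size p).
by apply/reachP; exists p.
Qed.

Lemma reach_iter (f : V -> V) n u :
  (forall v, E v (f v)) -> reach n u (iter n f u).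
Proof.
move=> Ef; elim: n => [|n IHn]; first by rewrite reach0.
by rewrite -addn1; apply: reach_add IHn _; rewrite addn1 reach1; apply: Ef.
Qed.

Lemma reach_mul m n u : reach m u u -> reach (m * n) u u.
Proof.
move=> Cu; elim: n => [|n IHn]; first by rewrite muln0 reach0.
by rewrite mulnS; apply: reach_add Cu IHn.
Qed.

Lemma connect_reach_mul n u v :
  connect (reach n) u v <-> exists k, reach (k * n) u v.
Proof.
split=> [/connectP[p]|[k]].
  elim: p u => [|x p IHp] u /= => [_ ->|/andP[Rux Rp] /(IHp _ Rp)[k Rk]].
    by exists 0; rewrite reach0.
  by exists k.+1; rewrite mulSn; apply: reach_add Rux Rk.
elim: k u => [|k IHk] u.
  by rewrite reach0 => /eqP ->; rewrite connect0.
rewrite mulSn => /reach_split[x Rux /IHk]; apply: connect_trans.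
exact: connect1.
Qed.

End Reach.

(** * Periodic orbits *)

Lemma periodic_point (T : finType) (f : T -> T) (x : T) :
  exists y, exists2 n, 0 < n & iter n f y == y.
Proof.
have /trajectP[i lt_i f_i] := looping_order f x.
exists (iter i f x), (order f x - i); first by rewrite subn_gt0.
by rewrite -iterD subnK ?f_i // ltnW.
Qed.

(** Stated up to an equivalence because it serves twice: for walk classes when [nu = 0], for
    equality when [nu > 0]. Here [g] is the least return time; a coincidence of iterates [i < j < g]
    would give the shorter return time [g - j + i]. *)
Lemma minimal_period (T : Type) (e : rel T) (f : T -> T) (x : T) :
    equivalence_rel e -> (forall y z, e y z -> e (f y) (f z)) ->
    (exists2 n, 0 < n & e (iter n f x) x) ->
  exists2 g, 0 < g &
    forall m n, e (iter m f x) (iter n f x) = (m == n %[mod g]).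
Proof.
move=> e_equiv ef ex_n.
have ee y : e y y by have [] := e_equiv y y y.
have eS y z : e y z -> e z y.
  by move=> eyz; have [_ /(_ eyz) <-] := e_equiv y z y.
have eC y z : e y z = e z y by apply/idP/idP; apply: eS.
have eT z y t : e y z -> e z t -> e y t.
  by move=> eyz; have [_ /(_ eyz) ->] := e_equiv y z t.
have ei k y z : e y z -> e (iter k f y) (iter k f z).
  by move=> eyz; elim: k => //= k; apply: ef.
have ex_g : exists g, (0 < g) && e (iter g f x) x.
  by case: ex_n => n n0 en; exists n; rewrite n0.
case: (ex_minnP ex_g) => g /andP[g0 eg] g_min; exists g => //.
have e_mod m : e (iter m f x) (iter (m %% g) f x).
  rewrite {1}(divn_eq m g) addnC iterD; apply/ei.
  elim: (m %/ g) => [|k IHk] /=; first exact: ee.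
  by rewrite mulSn iterD; apply: eT eg; apply: ei.
have no_lt i j : i < j -> j < g -> ~~ e (iter i f x) (iter j f x).
  move=> lt_ij lt_jg; apply/negP=> /(ei (g - j)).
  rewrite -!iterD subnK ?(ltnW lt_jg) // => eij.
  have := eT _ _ _ eij eg => e0.
  by have := g_min (g - j + i); rewrite e0 andbT; lia.
move=> m n; apply/idP/eqP=> [emn|mn].
  have {}emn : e (iter (m %% g) f x) (iter (n %% g) f x).
    by apply: (eT _ _ _ _ (e_mod n)); apply: eT emn; rewrite eC; apply: e_mod.
  have := ltn_pmod m g0; have := ltn_pmod n g0.
  case: (ltngtP (m %% g) (n %% g)) => // lt_mn ltn ltm.
    by rewrite (negPf (no_lt _ _ lt_mn ltn)) in emn.
  by rewrite eC (negPf (no_lt _ _ lt_mn ltm)) in emn.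
by apply: eT (e_mod m) _; rewrite mn eC; apply: e_mod.
Qed.

(** * The case [nu = 0]: coclique extensions *)

Lemma reach_eq_edge_coclique_extension (V : finType) (E : rel V) l :
    0 < #|V| -> irreflexive E -> 1 < l -> strongly_connected E ->
    (forall u, exists v, E u v) -> (forall u v, reach E l u v = E u v) ->
  exists2 g, 2 <= g & dicycle_coclique_extension E g.
Proof.
case/card_gt0P=> x _ E_irr l_gt1 E_conn E_succ El.
pose p := l.-1; have lE : l = p.+1 by rewrite /p; lia.
have p_gt0 : 0 < p by rewrite /p; lia.
pose e := connect (reach E p).
have eP u v : e u v <-> exists k, reach E (k * p) u v.
  exact: connect_reach_mul.
have Ek k u v : reach E (k * p).+1 u v -> E u v.
  elim: k v => [|k IHk] v; first by rewrite reach1.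
  rewrite mulSn -addnS addnC => /reach_split[w Ruw Rwv].
  by rewrite -El lE -addn1 addnC; apply: reach_add Rwv; rewrite reach1 IHk.
have eEr u v w : e u v -> E v w -> E u w.
  move=> /eP[k Ruv] Evw; apply: (Ek k).
  by rewrite -addn1; apply: reach_add Ruv _; rewrite reach1.
have eEl u v w : E u v -> e v w -> E u w.
  move=> Euv /eP[k Rvw]; apply: (Ek k).
  by rewrite -add1n; apply: reach_add Rvw; rewrite reach1.
have eS u v : e u v -> e v u.
  case/eP=> k Ruv; have [m Rvu] := connect_reach (E_conn v u).
  apply/eP; have Rvv := reach_add Rvu Ruv.
  (* The closed walk at [v] taken [p - 1] times, then the walk of length [m] to [u]: the total
     length is divisible by [p]. *)
  exists (m + k * p.-1); have -> : (m + k * p.-1) * p = (m + k * p) * p.-1 + m.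
    by rewrite -(prednK p_gt0) /=; nia.
  exact: reach_add (reach_mul p.-1 Rvv) Rvu.
have e_equiv : equivalence_rel e.
  move=> u v w; split=> [|euv]; first exact: connect0.
  apply/idP/idP; first exact: connect_trans (eS _ _ euv).
  exact: connect_trans euv.
have e_out u v v' : E u v -> E u v' -> e v v'.
  move=> Euv Euv'; have [m Rvu] := connect_reach (E_conn v u).
  apply/eP; exists m.+1.
  have -> : m.+1 * p = m.+1 * p.-1 + m.+1 by rewrite -mulnSr prednK.
  have Rvx w : E u w -> reach E m.+1 v w.
    by move=> Euw; rewrite -addn1; apply: reach_add Rvu _; rewrite reach1.
  by apply: reach_add (Rvx _ Euv'); apply/reach_mul/Rvx.
have [f Ef] : exists f, forall u, E u (f u).
  by exists (fun u => xchoose (E_succ u)) => u; apply: xchooseP.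
have ef u v : e u v -> e (f u) (f v).
  by move=> euv; apply: (@e_out u); rewrite ?Ef //; apply: eEr euv (Ef v).
have [g g_gt0 eg] := minimal_period (x := x) e_equiv ef
  (ex_intro2 _ _ p p_gt0 (eS _ _ (connect1 (reach_iter p x Ef)))).
pose s n := iter n f x.
have g_gt1 : 1 < g.
  rewrite ltn_neqAle g_gt0 andbT; apply/eqP=> g1.
  (* With a single class, [f x] would be equivalent to [x], and the edge from [x] to [f x] would
     yield a loop at [x]. *)
  have := eg 1 0; rewrite -g1 !modn1 eqxx /= => efx.
  by have := eEl _ _ _ (Ef x) efx; rewrite E_irr.
have cover u : exists n, e (s n) u.
  case/connectP: (E_conn x u) => q Eq ->.
  have : exists n, e (s n) x by exists 0; apply: connect0.
  move: {1 2 3}x Eq => z; elim: q z => //= y q IHq z /andP[Ezy Eq] [n sz].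
  apply: IHq Eq _; exists n.+1; apply: e_out (Ef _) _.
  exact: eEr sz Ezy.
have coverZ u : exists i : 'Z_g, e (s i) u.
  have [n snu] := cover u; exists (inZp n); apply: connect_trans snu.
  by rewrite -/e eg /= Zp_cast ?modn_mod.
have sD (i : 'Z_g) : e (s (i + 1)%R) (s i.+1).
  rewrite eg /= modnDmr addn1; apply/eqP.
  by rewrite [X in _ %% X %% _]Zp_cast ?modn_mod.
exists g => //; exists (fun i : 'Z_g => [set v | e (s i) v]); split.
- by move=> i; apply/set0Pn; exists (s i); rewrite inE; apply: connect0.
- move=> i j; apply: contraNT => /pred0Pn[u /andP[]]; rewrite !inE => siu sju.
  have := connect_trans siu (eS _ _ sju); rewrite -/e eg.
  have lt_g (k : 'Z_g) : k < g by rewrite -[X in _ < X](Zp_cast g_gt1).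
  by rewrite !modn_small ?lt_g.
- apply/setP=> u; rewrite inE; apply/bigcupP; have [i siu] := coverZ u.
  by exists i; rewrite // inE.
move=> u v; apply/idP/existsP=> [Euv|[i]].
  have [i siu] := coverZ u; exists i; rewrite !inE siu /=.
  apply: connect_trans (sD i) _; apply: e_out (Ef _) _.
  exact: eEr siu Euv.
rewrite !inE => /andP[siu siv]; apply: (@eEl u (s i.+1)).
  exact: eEr (eS _ _ siu) (Ef _).
exact: connect_trans (eS _ _ (sD i)) siv.
Qed.

(** * The case [nu > 0]: vertices off the cycle *)

Section Cycle.
Variables (V : finType) (E : rel V) (l k : nat) (c : nat -> V).
Hypotheses (E_irr : irreflexive E) (E_conn : strongly_connected E).
Hypotheses (l_gt1 : 1 < l) (k_gt0 : 0 < k).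
Hypothesis El : forall u v, reach E l u v -> u = v \/ E u v.
Hypothesis Ec : forall i, E (c i) (c i.+1).
Hypothesis Rc : forall i, reach E l.-1 (c i.+1) (c i).
Hypothesis c_eq : forall i j, (c i == c j) = (i == j %[mod k]).

Lemma edge_to_pred u i : E u (c i.+1) -> u = c i \/ E u (c i).
Proof.
move=> Eu; apply: El; rewrite -(ltn_predK l_gt1) -add1n.
by apply: reach_add (Rc i); rewrite reach1.
Qed.

Lemma edge_from_succ u i : E (c i) u -> c i.+1 = u \/ E (c i.+1) u.
Proof.
move=> Eu; apply: El; rewrite -(ltn_predK l_gt1) -addn1.
by apply: reach_add (Rc i) _; rewrite reach1.
Qed.

Lemma reach_cycle n i : reach E n (c i) (c (i + n)).
Proof.
elim: n => [|n IHn]; first by rewrite addn0 reach0.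
by rewrite addnS -[X in reach _ X]addn1; apply: reach_add IHn _; rewrite reach1.
Qed.

Lemma cycle_addM i n : c (i + k * n) = c i.
Proof. by apply/eqP; rewrite c_eq mulnC addnC modnMDl. Qed.

(** Raising an index by a multiple of [k] makes later truncated subtractions exact. *)
Lemma cycle_eq_above i n : exists2 j, n <= j & c i = c j.
Proof. by exists (i + k * n); rewrite ?cycle_addM //; nia. Qed.

Definition on_cycle v := [exists i : 'I_k, c i == v].

Lemma on_cycleP v : reflect (exists i, c i = v) (on_cycle v).
Proof.
apply: (iffP existsP) => [[i /eqP]|[i <-]]; first by exists i.
have lt_ik := ltn_pmod i k_gt0.
by exists (Ordinal lt_ik); rewrite c_eq /= modn_mod.
Qed.

Lemma outside_edge_to y i j : ~~ on_cycle y -> E y (c i) -> E y (c j).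
Proof.
move=> y_out; have [i' le_ji' ->] := cycle_eq_above i j.
rewrite -(subnK le_ji'); elim: (i' - j) => // n IHn.
rewrite addSn => /edge_to_pred[y_eq|//].
by case/on_cycleP: y_out; exists (n + j).
Qed.

Lemma outside_edge_from y i j : ~~ on_cycle y -> E (c i) y -> E (c j) y.
Proof.
move=> y_out; have [j' le_ij' ->] := cycle_eq_above j i.
rewrite -(subnK le_ij'); elim: (j' - i) => // n IHn Ey.
case: (edge_from_succ (IHn Ey)) => // y_eq.
by case/on_cycleP: y_out; exists (n + i).+1.
Qed.

(* A shortest walk from y to the cycle has length at most l: the first l      *)
(* steps of a longer one could be replaced by a single edge. It can then be   *)
(* prolonged along the cycle to a walk of length l ending at c j.             *)
Lemma outside_to y j : ~~ on_cycle y -> E y (c j).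
Proof.
move=> y_out.
have ex_n : exists n, [exists v, on_cycle v && reach E n y v].
  have [n Rn] := connect_reach (E_conn y (c 0)).
  exists n; apply/existsP; exists (c 0); rewrite Rn andbT.
  by apply/on_cycleP; exists 0.
case: (ex_minnP ex_n) => -[|n] /existsP[v /andP[/on_cycleP[i <-{v}] Rn]] n_min.
  by move: Rn; rewrite reach0 => /eqP y_eq; case/on_cycleP: y_out; exists i.
have {}n_min m i' : reach E m y (c i') -> n < m.
  move=> Rm; apply: n_min; apply/existsP; exists (c i'); rewrite Rm andbT.
  by apply/on_cycleP; exists i'.
have le_nl : n < l.
  rewrite ltnNge; apply/negP=> le_ln; move: Rn.
  rewrite -[n.+1](subnKC (leqW le_ln)) => /reach_split[z /El[<-|Eyz] Rz].
    by have := n_min _ _ Rz; lia.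
  have Ryz : reach E 1 y z by rewrite reach1.
  by have := n_min _ _ (reach_add Ryz Rz); lia.
move: Rn; rewrite -addn1 => /reach_split[z Rz]; rewrite reach1 => Ez.
have z_out : ~~ on_cycle z.
  by apply/on_cycleP=> -[i' z_eq]; rewrite -z_eq in Rz; have := n_min _ _ Rz; lia.
have [j' le_lj' cj] := cycle_eq_above j l.
have R1 : reach E 1 z (c (j' - (l - n.+1))).
  by rewrite reach1; apply: outside_edge_to Ez.
have := reach_add (reach_add Rz R1) (reach_cycle (l - n.+1) _).
rewrite addn1 subnKC // subnK -?cj; last by lia.
by case/El=> // y_eq; case/on_cycleP: y_out; exists j.
Qed.

(** Dual to [outside_to]: a shortest walk from the cycle to [y] is lengthened at its start by steps
    along the cycle beginning at [c j]. *)
Lemma outside_from y j : ~~ on_cycle y -> E (c j) y.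
Proof.
move=> y_out.
have ex_n : exists n, [exists v, on_cycle v && reach E n v y].
  have [n Rn] := connect_reach (E_conn (c 0) y).
  exists n; apply/existsP; exists (c 0); rewrite Rn andbT.
  by apply/on_cycleP; exists 0.
case: (ex_minnP ex_n) => -[|n] /existsP[v /andP[/on_cycleP[i <-{v}] Rn]] n_min.
  by move: Rn; rewrite reach0 => /eqP y_eq; case/on_cycleP: y_out; exists i.
have {}n_min m i' : reach E m (c i') y -> n < m.
  move=> Rm; apply: n_min; apply/existsP; exists (c i'); rewrite Rm andbT.
  by apply/on_cycleP; exists i'.
have le_nl : n < l.
  rewrite ltnNge; apply/negP=> le_ln; move: Rn.
  rewrite -[n.+1](subnK (leqW le_ln)) => /reach_split[z Rz /El[zy|Ezy]].
    by rewrite zy in Rz; have := n_min _ _ Rz; lia.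
  have Rzy : reach E 1 z y by rewrite reach1.
  by have := n_min _ _ (reach_add Rz Rzy); lia.
move: Rn; rewrite -add1n => /reach_split[z]; rewrite reach1 => Ez Rz.
have z_out : ~~ on_cycle z.
  by apply/on_cycleP=> -[i' z_eq]; rewrite -z_eq in Rz; have := n_min _ _ Rz; lia.
have R1 : reach E 1 (c (j + (l - n.+1))) z.
  by rewrite reach1; apply: outside_edge_from Ez.
have := reach_add (reach_cycle (l - n.+1) _) (reach_add R1 Rz).
rewrite add1n subnK //.
by case/El=> // y_eq; case/on_cycleP: y_out; exists j.
Qed.

(** Distinct [u] and [v] are joined by a walk of length [l]: through [l - 2] cycle steps if both are
    off the cycle, or by [l - 2] cycle steps and a detour through [x] if both are on it. *)
Lemma outside_complete x : ~~ on_cycle x -> complete_digraph E.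
Proof.
move=> x_out u v; apply/idP/idP=> [|neq_uv].
  by apply: contraTneq => ->; rewrite E_irr.
have [/on_cycleP[i u_eq]|u_out] := boolP (on_cycle u); last first.
  have [/on_cycleP[j <-]|v_out] := boolP (on_cycle v); first exact: outside_to.
  suff /El[uv|//] : reach E l u v by rewrite uv eqxx in neq_uv.
  have -> : l = 1 + (l - 2) + 1 by lia.
  apply: reach_add (_ : reach E 1 (c (l - 2)) v); last first.
    by rewrite reach1 outside_from.
  by apply: reach_add (reach_cycle _ 0); rewrite reach1 outside_to.
have [/on_cycleP[j v_eq]|v_out] := boolP (on_cycle v); last first.
  by rewrite -u_eq; apply: outside_from.
suff /El[uv|//] : reach E l u v by rewrite uv eqxx in neq_uv.
have -> : l = l - 2 + 1 + 1 by lia.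
apply: reach_add (_ : reach E 1 x v); last by rewrite reach1 -v_eq outside_to.
rewrite -u_eq; apply: reach_add (reach_cycle _ _) _.
by rewrite reach1 outside_from.
Qed.

(** * Spanning cycle: out-neighbourhoods are arcs *)

Hypothesis c_onto : forall v, on_cycle v.

Lemma cycle_neq i d : 0 < d < k -> c i != c (i + d).
Proof.
case/andP=> d_gt0 lt_dk; rewrite c_eq -{1}[i]addn0 eqn_modDl mod0n modn_small //.
by rewrite eq_sym -lt0n.
Qed.

Lemma k_gt1 : 1 < k.
Proof.
rewrite ltn_neqAle k_gt0 andbT; apply/eqP=> k1.
have /eqP c01 : c 0 == c 1 by rewrite c_eq -k1 !modn1.
by have := Ec 0; rewrite -c01 E_irr.
Qed.

Definition arc_bound i := \max_(d < k | E (c i) (c (i + d))) d.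
Local Notation t := arc_bound.

(** [edge_to_pred] shortens the longest arc one step at a time, so every smaller positive length
    also occurs. *)
Lemma arc_boundP i d : d < k -> E (c i) (c (i + d)) = (0 < d <= t i).
Proof.
move=> lt_dk; apply/idP/andP=> [Ed | [d_gt0 le_dt]].
  split; first by case: d Ed {lt_dk} => //; rewrite addn0 E_irr.
  by rewrite (leq_bigmax_cond (Ordinal lt_dk)).
have [e Ee te] : {e : 'I_k | E (c i) (c (i + e)) & t i = e}.
  apply: eq_bigmax_cond; apply/card_gt0P; exists (Ordinal k_gt1).
  by rewrite unfold_in /= addn1.
rewrite {}te in le_dt; have := ltn_ord e; rewrite -(subnK le_dt) in Ee *.
elim: (e - d) Ee => // n IHn; rewrite addSn addnS => /edge_to_pred[].
  move=> c_id lt_k; have /negP[] : c i != c (i + (n + d)).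
    by apply: cycle_neq; lia.
  by rewrite {1}c_id.
by move=> Ee lt_k; apply: IHn Ee (ltnW lt_k).
Qed.

Lemma arc_bound_lt i : t i < k.
Proof.
rewrite /arc_bound; elim/big_ind: _ => // m n lt_mk lt_nk.
by rewrite gtn_max lt_mk.
Qed.

Lemma arc_bound_gt0 i : 0 < t i.
Proof. by have := arc_boundP i k_gt1; rewrite addn1 Ec => /esym/andP[]. Qed.

(** [edge_from_succ] moves the start of the longest arc one step forward and keeps its end. *)
Lemma arc_boundS i : t i <= (t i.+1).+1.
Proof.
case: (t i) (arc_boundP i (arc_bound_lt i)) (arc_bound_lt i) => [|[|d]] //.
rewrite leqnn !addnS -!addSn => /edge_from_succ[c_id|Ed] lt_dk.
  have /negP[] : c i.+1 != c (i.+1 + d.+1) by apply: cycle_neq; lia.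
  by rewrite addnS -addSn {1}c_id.
by have := arc_boundP i.+1 (ltnW lt_dk); rewrite addnS -addSn Ed => /esym/andP[].
Qed.

Lemma arc_bound_mod i j : i = j %[mod k] -> t i = t j.
Proof.
move=> /eqP ij; have /eqP c_ij : c i == c j by rewrite c_eq.
apply: eq_bigl => d; rewrite c_ij; congr (E _ _); apply/eqP.
by rewrite c_eq eqn_modDr.
Qed.

Lemma full_arcs_complete : (forall i, t i = k.-1) -> complete_digraph E.
Proof.
move=> t_full u v; have /on_cycleP[i <-] := c_onto u.
have /on_cycleP[j0 <-] := c_onto v; have [j le_ij ->] := cycle_eq_above j0 i.
have lt_dk := ltn_pmod (j - i) k_gt0; set d := _ %% k in lt_dk.
have /eqP -> : c j == c (i + d) by rewrite c_eq modnDmr subnKC.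
rewrite arc_boundP // t_full; have [->|d_gt0] := posnP d.
  by rewrite addn0 eqxx.
by rewrite cycle_neq ?d_gt0 //; lia.
Qed.

(** * Walks along longest arcs *)

Section Greedy.
Variable j : nat.
Hypothesis t_j : t j < k.-1.

(* The end of the walk of n.+1 longest arcs from j, as an unreduced index. *)
Definition greedy n := iter n (fun x => x + t x) (j + t j).

Lemma greedyS n : greedy n.+1 = greedy n + t (greedy n).
Proof. by []. Qed.

Lemma greedy_mono m n : m <= n -> greedy m + (n - m) <= greedy n.
Proof.
move=> /subnK <-; rewrite addnK; elim: (n - m) => [|d IHd]; first by rewrite addn0.
by rewrite addSn greedyS; have := arc_bound_gt0 (greedy (d + m)); lia.
Qed.

(** No index is skipped: either the predecessor of [m] is reached with one arc fewer and a unit step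
    follows, or the last longest arc is shortened to end at [m]. *)
Lemma reach_greedy n m : j + n < m <= greedy n -> reach E n.+1 (c j) (c m).
Proof.
elim: n m => [|n IHn] m /andP[lt_jm le_m].
  rewrite /greedy /= in le_m; rewrite reach1.
  have -> : m = j + (m - j) by lia.
  by rewrite arc_boundP; [apply/andP|]; lia.
rewrite -addn1; have [le_mB|lt_Bm] := leqP m.-1 (greedy n).
  have -> : m = m.-1.+1 by lia.
  by apply: reach_add (_ : reach E 1 (c m.-1) _); [apply: IHn; lia | rewrite reach1 Ec].
have lt_tk := arc_bound_lt (greedy n); rewrite greedyS in le_m.
have lt_jB := greedy_mono (leq0n n); have t_gt0 := arc_bound_gt0 j.
rewrite /(greedy 0) /= in lt_jB.
apply: reach_add (IHn (greedy n) _) _; first by lia.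
rewrite reach1; have -> : m = greedy n + (m - greedy n) by lia.
by rewrite arc_boundP; [apply/andP|]; lia.
Qed.

(* The walks of length l from c j reach c m for every m from j + l to         *)
(* greedy l.-1, and these must all be residues of j, ..., j + t j.            *)
Lemma greedy_bound : l %% k + greedy l.-1 <= j + t j + l.
Proof.
have in_arc m : j + l <= m <= greedy l.-1 -> (m - j) %% k <= t j.
  move=> /andP[le_m m_le].
  have /El : reach E l (c j) (c m).
    by rewrite -(ltn_predK l_gt1); apply: reach_greedy; lia.
  have lt_dk := ltn_pmod (m - j) k_gt0; set d := _ %% k in lt_dk *.
  have /eqP -> : c m == c (j + d) by rewrite c_eq modnDmr subnKC //; lia.
  rewrite arc_boundP // => -[c_id|/andP[] //].
  rewrite leqNgt; apply/negP=> lt_td.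
  have /negP[] : c j != c (j + d) by apply: cycle_neq; lia.
  by rewrite {1}c_id.
have := greedy_mono (leq0n l.-1); rewrite /(greedy 0) /= => le_B.
have t_gt0 := arc_bound_gt0 j.
have := in_arc (j + l); rewrite addKn => /(_ _)-/(_ ltac:(lia)) le_at.
rewrite leqNgt; apply/negP=> lt_B.
(* The least offset from [l] on with residue [t j + 1]; since [t j < k - 1], this residue does not
   wrap around, and it lies outside the arc. *)
have := in_arc (j + (l + (t j - l %% k).+1)) ltac:(lia).
by rewrite addKn -modnDml addnS subnKC // modn_small ?ltnn //; lia.
Qed.

(** [greedy_bound] gives [l %% k <= 1], hence [k <= l], so the [l - 1] arcs after the first start at
    all residues but at most one. Either all have length 1, or exactly one has length 2;
    [arc_boundS] bounds the arc at the residue left over. *)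
Lemma arc_bound_almost_1 :
  exists p, [/\ t p <= 2, t p.+1 <= 2 &
               forall y, p.+2 <= y -> y < p + k -> t y = 1].
Proof.
have B_bound := greedy_bound.
have k_gt2 : 2 < k by have := arc_bound_gt0 j; lia.
have B_mono := greedy_mono; have tS := arc_boundS.
have t_gt0 := arc_bound_gt0.
pose b := j + t j; have B0 : greedy 0 = b by [].
have t_k x : t (x + k) = t x by apply: arc_bound_mod; rewrite modnDr.
have a_le1 : l %% k <= 1 by have := B_mono 0 l.-1 (leq0n _); lia.
have le_kl : k <= l.
  by rewrite leqNgt; apply/negP=> lt_lk; rewrite modn_small in a_le1; lia.
rewrite -/b in B_bound.
have [B_eq|lt_B] := leqP (greedy l.-1) (b + l.-1).
  have t1 i : i < l.-1 -> t (b + i) = 1.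
    move=> lt_il; have := greedyS i.
    have := B_mono 0 i (leq0n _); have := B_mono i _ (ltnW lt_il).
    have := B_mono _ _ lt_il => le1 le2 le3 eqS.
    have -> : b + i = greedy i by lia.
    by have := t_gt0 (greedy i); lia.
  (* The one residue not among the starting points [b, ..., b + k - 2] of unit arcs. *)
  exists (b + k.-1).
  have -> : (b + k.-1).+1 = b + k by lia.
  rewrite t_k; have := tS (b + k.-1).
  have -> : (b + k.-1).+1 = b + k by lia.
  rewrite t_k; have := t1 0; rewrite addn0 => ->; last by lia.
  split=> // y le_y lt_y.
  have -> : y = (b + (y - k - b)) + k by lia.
  by rewrite t_k t1 //; lia.
have ex_n : exists n, (n <= l.-1) && (b + n < greedy n).
  by exists l.-1; rewrite leqnn.
case: (ex_minnP ex_n) => -[|i0]; first by rewrite B0 addn0 ltnn andbF.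
move=> /andP[le_i0l lt_Bi0] i0_min.
have before i : i <= i0 -> greedy i = b + i.
  move=> le_i; have := B_mono 0 i (leq0n _).
  have : ~~ (b + i < greedy i).
    by apply/negP=> lt_B'; have := i0_min i; lia.
  by lia.
have after i : i0 < i -> i <= l.-1 -> greedy i = b + i.+1.
  move=> lt_i le_il; have := B_mono _ _ lt_i; have := B_mono _ _ le_il.
  by lia.
(* The start of the single arc of length 2; the successor of this index is the one skipped. *)
exists (greedy i0).
have t_eq i : t (greedy i) = greedy i.+1 - greedy i by rewrite greedyS addKn.
have t_p : t (greedy i0) = 2.
  by rewrite t_eq after // before //; lia.
have t1 y : (greedy i0).+2 <= y -> y < greedy i0 + k -> t y = 1.
  rewrite before // => le_y lt_y.
  have [lt_yl|le_ly] := ltnP y (b + l).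
    have -> : y = greedy (y - b).-1 by rewrite after; lia.
    by rewrite t_eq !after; lia.
  have -> : y = greedy (y - k - b) + k by rewrite before; lia.
  by rewrite t_k t_eq !before; lia.
split; [by rewrite t_p| |exact: t1].
by have := tS (greedy i0).+1; rewrite (t1 (greedy i0).+2) //; lia.
Qed.

End Greedy.

(** * Identification with digraphs on ['Z_k] *)

Lemma cycle_edge x y :
  t x <= 2 -> E (c x) (c y) = (c y == c x.+1) || (t x == 2) && (c y == c x.+2).
Proof.
have [y' le_xy ->] := cycle_eq_above y x.
have lt_dk := ltn_pmod (y' - x) k_gt0; set d := _ %% k in lt_dk *.
have /eqP -> : c y' == c (x + d) by rewrite c_eq modnDmr subnKC.
rewrite arc_boundP // -[x.+2]addn2 -[x.+1]addn1 !c_eq !eqn_modDl => tx_le2.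
have := arc_bound_lt x; have := arc_bound_gt0 x; have := k_gt1.
rewrite (modn_small lt_dk) => k_gt1 t_gt0 t_lt; rewrite (modn_small k_gt1).
have [t2|t1] : t x = 2 \/ t x = 1 by lia.
  by rewrite t2 /= modn_small; lia.
by rewrite t1 orbF; lia.
Qed.

(** Labelling from [p] puts the two exceptional vertices at 0 and 1. *)
Definition cycle_pos p (i : 'Z_k) := c (p + i).

Lemma cycle_pos_nat p n : cycle_pos p n%:R%R = c (p + n).
Proof.
by apply/eqP; rewrite c_eq val_Zp_nat ?k_gt1 // modnDmr.
Qed.

Lemma cycle_pos_inj p : injective (cycle_pos p).
Proof.
move=> i j /eqP; rewrite c_eq eqn_modDl => /eqP ij; apply: val_inj => /=.
have lt_k (h : 'Z_k) : h < k by rewrite -[X in _ < X](Zp_cast k_gt1).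
by rewrite !modn_small ?lt_k in ij.
Qed.

Lemma cycle_pos_onto p v : exists i, cycle_pos p i == v.
Proof.
have /on_cycleP[n <-] := c_onto v; have [m le_pm ->] := cycle_eq_above n p.
by exists (m - p)%:R%R; rewrite cycle_pos_nat subnKC.
Qed.

Lemma cycle_digraph_iso p (F : rel 'Z_k) :
  (forall i j, F i j = E (cycle_pos p i) (cycle_pos p j)) -> digraph_iso E F.
Proof.
move=> FE; pose h v := xchoose (cycle_pos_onto p v).
have hK : cancel h (cycle_pos p).
  by move=> v; apply/eqP/(xchooseP (cycle_pos_onto p v)).
exists h => [|u v]; last by rewrite FE !hK.
by exists (cycle_pos p) => // i; apply: (@cycle_pos_inj p); rewrite hK.
Qed.

Lemma cycle_pos_edge p :
    t p <= 2 -> t p.+1 <= 2 -> (forall y, p.+2 <= y -> y < p + k -> t y = 1) ->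
  forall i j, E (cycle_pos p i) (cycle_pos p j) =
    [|| dicycle i j, [&& t p == 2, i == 0%R & j == 2%R]
      | [&& t p.+1 == 2, i == 1%R & j == 3%R]].
Proof.
move=> tp_le2 tp1_le2 t1 i j.
have lt_k (h : 'Z_k) : h < k by rewrite -[X in _ < X](Zp_cast k_gt1).
have t_le2 : t (p + i) <= 2.
  case: (i : nat) (lt_k i) => [|[|m]] lt_m; rewrite ?addn0 ?addn1 //.
  by rewrite t1 //; lia.
rewrite [cycle_pos p i]/cycle_pos cycle_edge //.
have pos_add n : (cycle_pos p j == c (p + i + n)) = (j == i + n%:R)%R.
  rewrite -addnA -cycle_pos_nat natrD Zp_nat valZpK.
  exact: (inj_eq (@cycle_pos_inj p)).
rewrite -[(p + i).+2]addn2 -[(p + i).+1]addn1 !pos_add.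
congr (_ || _).
have [i0|[i1|i_ge2]] : i = 0%R \/ i = 1%R \/ 1 < i.
  have := natr_Zp i; case: (i : nat) => [|[|m]] <-; [by left|by right; left|].
  by right; right.
- by rewrite i0 addn0 add0r eqxx (eq_sym 0%R) oner_eq0 andbF orbF.
- have val1 : (1%R : 'Z_k) = 1 :> nat.
    by rewrite -[1%R]/(1%:R)%R val_Zp_nat ?modn_small ?k_gt1.
  have -> : (i + 2 = 3)%R by rewrite i1 -[1%R in LHS]/(1%:R)%R -natrD.
  by rewrite i1 val1 addn1 oner_eq0 eqxx andbF.
have lt_ik := lt_k i; have t_pi : t (p + i) = 1 by rewrite t1 //; lia.
have i_neq (n : nat) : n <= 1 -> (i == n%:R)%R = false.
  move=> n_le1; apply: contraTF i_ge2 => /eqP ->.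
  by rewrite val_Zp_nat ?k_gt1 // modn_small -?leqNgt //; have := k_gt1; lia.
by rewrite t_pi (i_neq 0) // (i_neq 1) // !andbF.
Qed.

Lemma cycle_classification :
  [\/ complete_digraph E, digraph_iso E (@dicycle k),
      3 <= k /\ digraph_iso E (@dicycle_plus_02 k)
    | 3 <= k /\ digraph_iso E (@dicycle_plus_02_13 k)].
Proof.
have [/existsP[j t_j]|] := boolP [exists j : 'I_k, t j < k.-1]; last first.
  rewrite negb_exists => /forallP t_full; constructor 1.
  apply: full_arcs_complete => i; rewrite (@arc_bound_mod i (i %% k)) ?modn_mod //.
  have := t_full (Ordinal (ltn_pmod i k_gt0)); rewrite -leqNgt /= => t_ge.
  by apply/eqP; rewrite eqn_leq t_ge andbT; have := arc_bound_lt (i %% k); lia.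
have k_gt2 : 2 < k by have := arc_bound_gt0 j; lia.
have [p [tp_le2 tp1_le2 t1]] := arc_bound_almost_1 t_j.
have tE := cycle_pos_edge tp_le2 tp1_le2 t1.
have [tp2|tp_neq2] := eqVneq (t p) 2; have [tp12|tp1_neq2] := eqVneq (t p.+1) 2.
- constructor 4; split=> //; apply: (@cycle_digraph_iso p) => a b.
  by rewrite tE tp2 tp12.
- constructor 3; split=> //; apply: (@cycle_digraph_iso p) => a b.
  by rewrite tE tp2 (negPf tp1_neq2) orbF.
(* Only [p.+1] is exceptional, so the labelling is restarted there to move the extra edge to 0. *)
- have tp2_eq1 : t p.+2 = 1 by rewrite t1 //; lia.
  have tE1 : forall i j, _ := @cycle_pos_edge p.+1 tp1_le2 _ _.
  constructor 3; split=> //; apply: (@cycle_digraph_iso p.+1) => a b.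
  rewrite tE1 ?tp2_eq1 // ?tp12 ?orbF // => y le_y lt_y.
  have [lt_yk|le_ky] := ltnP y (p + k); first by rewrite t1 //; lia.
  have -> : y = p + k by lia.
  by rewrite (@arc_bound_mod _ p) ?modnDr //; have := arc_bound_gt0 p; lia.
constructor 2; apply: (@cycle_digraph_iso p) => a b.
by rewrite tE (negPf tp_neq2) (negPf tp1_neq2) !orbF.
Qed.
End Cycle.

(** * Splitting by whether [nu] vanishes *)

Theorem theorem4p2 (V : finType) (E : rel V) (l lambda mu nu : nat)
    (V_nonempty : (0 < #|V|)%N) (E_loopless : irreflexive E)
    (l_gt1 : (1 < l)%N)
    (E_connected : strongly_connected E)
    (E_regular : strongly_walk_regular E l lambda mu nu)
    (mu0 : mu = 0%N)
    (E_noncomplete : ~ complete_digraph E) :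
  [\/ exists2 g : nat, (2 <= g)%N & digraph_iso E (@dicycle g),
      exists2 g : nat, (2 <= g)%N & dicycle_coclique_extension E g,
      exists2 m : nat, (3 <= m)%N & digraph_iso E (@dicycle_plus_02 m)
    | exists2 m : nat, (3 <= m)%N & digraph_iso E (@dicycle_plus_02_13 m)].
Proof.
have reach_card u v : reach E l u v = (0 < #|walks E l u v|) by rewrite card_gt0.
have El u v : reach E l u v -> u = v \/ E u v.
  rewrite reach_card; case: (E_regular u v) => _ mu_walks _.
  have [|neq_uv] := eqVneq u v; first by left.
  have [|nEuv] := boolP (E u v); first by right.
  by rewrite mu_walks // mu0.
have E_succ u : exists v, E u v.
  have [v Euv|Eu0] := pickP (E u); first by exists v.
  (* A vertex without out-neighbours would be the only vertex, and a single loopless vertex is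
     complete. *)
  have all_u v : v = u.
    have /connectP[[|x p] //=] := E_connected u v.
    by rewrite Eu0.
  by case: E_noncomplete => x y; rewrite (all_u x) (all_u y) E_loopless eqxx.
have [nu0|nu_gt0] := posnP nu.
  have {}El u v : reach E l u v -> E u v.
    move=> Ruv; case: (El _ _ Ruv) => // uv.
    move: Ruv; rewrite reach_card; case: (E_regular u v) => _ _ nu_walks.
    by rewrite nu_walks // nu0.
  have [f Ef] : exists f, forall u, E u (f u).
    by exists (fun u => xchoose (E_succ u)) => u; apply: xchooseP.
  (* Following [f] for [l] steps is a walk whose ends must be adjacent, so [lambda] counts at least
     one walk; this makes every edge a pair joined by a walk of length [l]. *)
  have lambda_gt0 : 0 < lambda.
    case/card_gt0P: V_nonempty => x _; have Rx := reach_iter l x Ef.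
    by have [<-] := E_regular x (iter l f x); rewrite -?reach_card ?El.
  constructor 2; apply: (@reach_eq_edge_coclique_extension V E l) => // u v.
  apply/idP/idP=> [/El//|Euv]; rewrite reach_card.
  by have [->] := E_regular u v.
have nu_reach u : reach E l u u.
  by rewrite reach_card; have [_ _ ->] := E_regular u u.
have ex_f u : exists v, E u v && reach E l.-1 v u.
  have := nu_reach u; rewrite -(ltn_predK l_gt1) -add1n.
  by case/reach_split=> v; rewrite reach1 => Euv Rvu; exists v; rewrite Euv.
pose f u := xchoose (ex_f u).
have fP u : E u (f u) /\ reach E l.-1 (f u) u by apply/andP/(xchooseP (ex_f u)).
have [x f_x] : exists x, exists2 n, 0 < n & iter n f x == x.
  by case/card_gt0P: V_nonempty => y _; apply: periodic_point.
have eq_equiv : equivalence_rel (@eq_op V).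
  by move=> u v w; split=> // /eqP ->.
have f_eq u v : u == v -> f u == f v by move=> /eqP ->.
have [k k_gt0 c_eq] := minimal_period eq_equiv f_eq f_x.
pose c i := iter i f x.
have Ec i : E (c i) (c i.+1) by case: (fP (c i)).
have Rc i : reach E l.-1 (c i.+1) (c i) by case: (fP (c i)).
have [c_onto|/forallPn[y y_out]] := altP (forallP (P := on_cycle k c)); last first.
  by case: E_noncomplete; apply: outside_complete Ec Rc c_eq y y_out.
have k_gt1 : 1 < k by apply: k_gt1 Ec c_eq.
have [//|iso|[k_gt2 iso]|[k_gt2 iso]] :=
  cycle_classification E_loopless l_gt1 k_gt0 El Ec Rc c_eq c_onto.
- by constructor 1; exists k.
- by constructor 3; exists k.
- by constructor 4; exists k.
Qed.
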